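(* Let $n_1,m_1,n_2,m_2\ge1$ be integers with $n_1+n_2=m_1+m_2$ and let $\mathbf{S}=(1^{n_1},\ast^{m_1},1^{n_2},\ast^{m_2})$. Then \[ |NC_2(\mathbf{S})|=1+\min\{n_1,m_1,n_2,m_2\},\qquad |NC(\mathbf{S})|=1+2\min\{n_1,m_1,n_2,m_2\}. \]
   Context: $1^k$ denotes $k$ consecutive entries $1$ (similarly $\ast^k$); $\mathbf{S}$ has length $N=2(n_1+n_2)$. $NC(\mathbf{S})$ is the set of non-crossing partitions of $\{1,\ldots,N\}$ each of whose blocks has even size and, with its elements in increasing order, has corresponding entries of $\mathbf{S}$ alternating between $1$ and $\ast$. $NC_2(\mathbf{S})$ is the subset of $NC(\mathbf{S})$ consisting of pairings (all blocks of size $2$). *)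

(* Defs.v *)
From mathcomp Require Import all_boot.
Set Implicit Arguments. Unset Strict Implicit. Unset Printing Implicit Defensive.

(* A word in {1, *}: true encodes 1, false encodes *.  Positions are 0-based
   ordinals 'I_(size s) (positions 1..N of the paper shifted by one). *)

Definition word_S (n1 m1 n2 m2 : nat) : seq bool :=
  nseq n1 true ++ nseq m1 false ++ nseq n2 true ++ nseq m2 false.

Definition entry (s : seq bool) (i : 'I_(size s)) : bool := nth false s i.

Definition is_set_partition (s : seq bool) (P : {set {set 'I_(size s)}}) : bool :=
  partition P [set: 'I_(size s)].

Definition noncrossing (s : seq bool) (P : {set {set 'I_(size s)}}) : bool :=
  [forall B1 in P, forall B2 in P, (B1 != B2) ==>
     [forall a : 'I_(size s), forall b : 'I_(size s), forall c : 'I_(size s),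
      forall d : 'I_(size s),
        ~~ [&& (a < b)%N, (b < c)%N, (c < d)%N, a \in B1, c \in B1,
              b \in B2 & d \in B2]]].

Definition alternating (s : seq bool) (B : {set 'I_(size s)}) : bool :=
  [forall x in B, forall y in B,
     ((x < y)%N && [forall z in B, ~~ ((x < z)%N && (z < y)%N)]) ==>
       (entry x != entry y)].

Definition is_NC (s : seq bool) (P : {set {set 'I_(size s)}}) : bool :=
  [&& is_set_partition P, noncrossing P &
      [forall B in P, ~~ odd #|B| && alternating B]].

Definition NC (s : seq bool) : {set {set {set 'I_(size s)}}} :=
  [set P | is_NC P].

Definition NC2 (s : seq bool) : {set {set {set 'I_(size s)}}} :=
  [set P in NC s | [forall B in P, #|B| == 2]].

(* Main.v *)
(* Since letters alternate in a block, a block meets each of the four runs at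
   most once, so blocks are pairs joining cyclically adjacent runs or quadruples
   meeting every run, and two quadruples would cross.  If i < j lie in one block
   and in adjacent runs, every other block is entirely inside or outside [i, j],
   so [i, j] holds as many 1's as *'s; this determines j from i and the two
   runs.  Noncrossing orders the first run: first the positions joined to the
   fourth run only (t of them), then possibly one quadruple (e = 1), then the
   positions joined to the second run only.  Hence a partition is determined by
   (t, e), and the admissible pairs are n1 - m1 <= t and t + e <= min(n1, m2). *)
Require Import Defs.
From mathcomp Require Import all_boot zify.
Set Implicit Arguments. Unset Strict Implicit. Unset Printing Implicit Defensive.

(** * The four runs and the letters in an interval *)

Section FourRuns.

Variables n1 m1 n2 m2 : nat.

Local Notation len := (n1 + m1 + n2 + m2).
Local Notation s := (word_S n1 m1 n2 m2).

(** The runs are numbered 0 to 3, so the even ones carry the letter 1; a position past the end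
    counts as lying in run 3. *)
Definition run (i : nat) : nat := (n1 <= i) + (n1 + m1 <= i) + (n1 + m1 + n2 <= i).

(* The smallest element of the block of [i] in the partition with parameters [t]
   and [e]. *)
Definition label (t : nat) (e : bool) (i : nat) : nat :=
  match run i with
  | 0 => i
  | 1 => if i + t < 2 * n1 then 2 * n1 - i.+1 else i
  | 2 => if i < 2 * m1 + t then 2 * (n1 + m1) - i.+1
         else if e && (i == 2 * m1 + t) then t else i
  | _ => if len <= i + t + e then len - i.+1 else 2 * (n1 + m1 + n2) - i.+1
  end.

(** The [n1 - t] positions joined to the second run must fit among its [m1] letters, and the first
    [t + e] positions must exist in the first run and fit in the fourth. *)
Definition valid (t : nat) (e : bool) : bool :=
  [&& n1 <= t + m1, t + e <= n1 & t + e <= m2].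

(* The last two disjuncts are the diagonals of the quadruple. *)
Definition joined (t : nat) (e : bool) (i j : nat) : bool :=
  [|| [&& run i == 0, run j == 1, i + j + 1 == 2 * n1 & t <= i],
      [&& run i == 0, run j == 3, i + j + 1 == len & i < t + e],
      [&& run i == 1, run j == 2, i + j + 1 == 2 * (n1 + m1) & 2 * n1 <= i + t + e],
      [&& run i == 2, run j == 3, i + j + 1 == 2 * (n1 + m1 + n2) & 2 * m1 + t <= i],
      [&& e, run i == 0, run j == 2, i == t & j == 2 * m1 + t] |
      [&& e, run i == 1, run j == 3, i + t + 1 == 2 * n1 & j + t + 1 == len]].

Variant run_spec (i : nat) : nat -> Type :=
  | Run0 of i < n1 : run_spec i 0
  | Run1 of n1 <= i < n1 + m1 : run_spec i 1
  | Run2 of n1 + m1 <= i < n1 + m1 + n2 : run_spec i 2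
  | Run3 of n1 + m1 + n2 <= i : run_spec i 3.

Lemma runP i : run_spec i (run i).
Proof.
have [h|h] := ltnP i n1.
  by have -> : run i = 0; [rewrite /run; lia | constructor].
have [h'|h'] := ltnP i (n1 + m1).
  by have -> : run i = 1; [rewrite /run; lia | constructor; lia].
have [h''|h''] := ltnP i (n1 + m1 + n2).
  by have -> : run i = 2; [rewrite /run; lia | constructor; lia].
by have -> : run i = 3; [rewrite /run; lia | constructor; lia].
Qed.

Lemma size_word : size s = len.
Proof. by rewrite !size_cat !size_nseq !addnA. Qed.

Lemma ord_word_lt (i : 'I_(size s)) : i < len.
Proof. by rewrite -size_word. Qed.

Lemma entry_run (i : 'I_(size s)) : entry i = ~~ odd (run i).
Proof.
rewrite /entry !nth_cat !size_nseq !nth_nseq.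
have := ord_word_lt i; case: (runP i) => h hi /=; repeat (case: ifP => /= ?); lia.
Qed.

Lemma run_le i j : i <= j -> run i <= run j.
Proof. by rewrite /run; lia. Qed.

Lemma run_lt4 i : run i < 4.
Proof. by case: runP. Qed.

(** This counts the 1's of the interval [x, y] below [M], with one truncated difference for each of
    the two runs of 1's. Cutting at [M] makes it provable by induction. *)
Lemma sum_even_run x y M :
  \sum_(0 <= k < M) ((x <= k <= y) && ~~ odd (run k) : nat) =
  (minn (minn y.+1 M) n1 - x) + (minn (minn y.+1 M) (n1 + m1 + n2) - maxn x (n1 + m1)).
Proof.
elim: M => [|M IH]; first by rewrite big_nil; lia.
rewrite big_nat_recr //= IH; case: (runP M) => h /=; lia.
Qed.

Lemma sum_odd_run x y M :
  \sum_(0 <= k < M) ((x <= k <= y) && odd (run k) : nat) =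
  (minn (minn y.+1 M) (n1 + m1) - maxn x n1) + (minn y.+1 M - maxn x (n1 + m1 + n2)).
Proof.
elim: M => [|M IH]; first by rewrite big_nil; lia.
rewrite big_nat_recr //= IH; case: (runP M) => h /=; lia.
Qed.

(** * The explicit partitions given by the labels *)

Hypothesis balanced_word : n1 + n2 = m1 + m2.

(** Turns every question about blocks into linear conditions on positions, one for each pair of
    runs. *)
Lemma label_eq t e i j :
  valid t e -> i < j < len -> (label t e i == label t e j) = joined t e i j.
Proof.
rewrite /valid /label /joined => vte ij.
case: (runP i) => hi; case: (runP j) => hj /=; rewrite ?andbF ?orbF ?orFb;
  try (exfalso; clear vte; lia);
  case: e vte => /= vte; repeat (case: ifP => /= ?); lia.
Qed.


(** Arcs joining the same two runs have a common centre, so they nest; the thresholds keep arcs of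
    different pairs of runs apart. Only the diagonals of the quadruple cross, and they lie in one
    block. *)
Lemma label_noncrossing t e i j k l : valid t e -> i < j -> j < k -> k < l < len ->
  label t e i == label t e k -> label t e j == label t e l -> label t e i == label t e j.
Proof.
move=> vte ij jk kl; rewrite !label_eq //; try lia.
rewrite /valid in vte; rewrite /joined.
by case: (runP i) => hi; case: (runP j) => hj; try (exfalso; lia);
   case: (runP k) => hk; try (exfalso; lia); case: (runP l) => hl /=;
   rewrite ?andbF ?orbF ?orFb //; lia.
Qed.

Lemma label_pair t e i : valid t e -> i < len -> ~~ (e && (label t e i == t)) ->
  exists2 p, (p < len) && (p != i) &
    forall j, j < len -> (label t e i == label t e j) = (j == i) || (j == p).
Proof.
move=> vte ilen nq; rewrite /valid in vte.
(* The partner of [i] is its reflection in the boundary with the adjacent run it is joined to, the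
   word being read cyclically. *)
exists (match run i with
  | 0 => if i < t then len - i.+1 else 2 * n1 - i.+1
  | 1 => if i + t < 2 * n1 then 2 * n1 - i.+1 else 2 * (n1 + m1) - i.+1
  | 2 => if i < 2 * m1 + t then 2 * (n1 + m1) - i.+1 else 2 * (n1 + m1 + n2) - i.+1
  | _ => if len <= i + t then len - i.+1 else 2 * (n1 + m1 + n2) - i.+1
  end).
  move: nq; rewrite /label; case: (runP i) => hi; repeat (case: ifP => /= ?); lia.
move=> j jlen; move: nq; rewrite /label.
case: (runP i) => hi; case: (runP j) => hj;
  case: e vte => /= vte; repeat (case: ifP => /= ?); lia.
Qed.

(** The four vertices are [t] and its successive reflections in the three inner boundaries. By
    balance the last one, [len - t.+1], is also the cyclic reflection of [t], so the quadruple
    closes up. *)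
Lemma label_quad t i j : valid t true -> i < len -> j < len -> label t true i == t ->
  (label t true i == label t true j) =
  [|| j == t, j == 2 * n1 - t.+1, j == 2 * m1 + t | j == len - t.+1].
Proof.
move=> vte ilen jlen /eqP ->; rewrite /valid in vte.
rewrite /label; case: (runP j) => hj; repeat (case: ifP => /= ?); lia.
Qed.

Definition run_partition (t : nat) (e : bool) : {set {set 'I_(size s)}} :=
  preim_partition (fun i : 'I_(size s) => label t e i) setT.

Lemma run_partitionP t e (B : {set 'I_(size s)}) : B \in run_partition t e ->
  exists i : 'I_(size s), B = [set j : 'I_(size s) | label t e i == label t e j].
Proof.
case/imsetP => i _ ->; exists i; apply/setP => j; by rewrite !inE.
Qed.

Lemma card_block t e (B : {set 'I_(size s)}) : valid t e -> B \in run_partition t e ->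
  #|B| = if e && [exists i in B, label t e i == t] then 4 else 2.
Proof.
move=> vte /run_partitionP[i ->]; have il := ord_word_lt i.
have -> : [exists j in [set j : 'I_(size s) | label t e i == label t e j], label t e j == t]
       = (label t e i == t).
  apply/existsP/idP => [[j]|it]; first by rewrite inE => /andP[/eqP -> ].
  by exists i; rewrite inE eqxx.
case: ifP => [/andP[te it]|/negbT nq]; last first.
  have [p /andP[pl pi] labE] := label_pair vte il nq.
  rewrite -size_word in pl; pose p' := Ordinal pl.
  have -> : [set j : 'I_(size s) | label t e i == label t e j] = [set i; p'].
    by apply/setP => j; rewrite !inE labE ?ord_word_lt.
  by rewrite cards2 eq_sym -val_eqE /= pi.
rewrite te in vte it *.
move: (vte); rewrite /valid => vte'.
have lt1 : t < size s by rewrite size_word; lia.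
have lt2 : 2 * n1 - t.+1 < size s by rewrite size_word; lia.
have lt3 : 2 * m1 + t < size s by rewrite size_word; lia.
have lt4 : len - t.+1 < size s by rewrite size_word; lia.
have -> : [set j : 'I_(size s) | label t true i == label t true j]
   = Ordinal lt1 |: (Ordinal lt2 |: [set Ordinal lt3; Ordinal lt4]).
  by apply/setP => j; rewrite !inE label_quad ?ord_word_lt // -!val_eqE.
rewrite !cardsU1 cards1 !inE -!val_eqE /=; lia.
Qed.

Lemma run_partition_NC t e : valid t e -> run_partition t e \in NC s.
Proof.
move=> vte; rewrite inE; apply/and3P; split; first exact: preim_partitionP.
  apply/forall_inP => B1 /run_partitionP[x ->].
  apply/forall_inP => B2 /run_partitionP[y ->]; apply/implyP => neq.
  apply/forallP => a; apply/forallP => b; apply/forallP => c;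
  apply/forallP => d; apply: contraNN neq.
  rewrite !inE => /and5P[ab bc cd /eqP xa /and3P[/eqP xc /eqP yb /eqP yd]].
  apply/eqP/setP => z; rewrite !inE xa yb.
  have := @label_noncrossing t e a b c d vte ab bc.
  by rewrite cd ord_word_lt -xa -xc -yd -yb !eqxx => /(_ isT isT isT)/eqP ->.
apply/forall_inP => B BQ; rewrite (card_block vte BQ); apply/andP; split; first by case: ifP.
have [i Bi] := run_partitionP BQ.
apply/forall_inP => x; rewrite {1}Bi inE => /eqP ix.
apply/forall_inP => y; rewrite {1}Bi inE ix => xy.
apply/implyP => /andP[ltxy /forall_inP gap].
have {}gap z (zl : z < len) : label t e x == label t e z -> (x < z < y) = false.
  rewrite -size_word in zl => xz; apply/negbTE.
  by apply: (gap (Ordinal zl)); rewrite Bi inE ix.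
have yl := ord_word_lt y; rewrite !entry_run.
have := label_eq vte (introT andP (conj ltxy yl)); rewrite xy /joined => /esym.
move: (vte); rewrite /valid => vte'.
(* Adjacent runs carry opposite letters, so only the two diagonals of the quadruple remain. Each has
   another vertex strictly between its ends, against [gap]. *)
case: (runP x) => hx; case: (runP y) => hy //=; rewrite ?andbF ?orbF //= => jn.
- have ml : 2 * n1 - t.+1 < len by lia.
  have xm : x < 2 * n1 - t.+1 < len by lia.
  have := gap _ ml; rewrite (label_eq vte xm) /joined.
  by case: (runP x) => ?; case: (runP (2 * n1 - t.+1)) => ? /=; lia.
- have ml : 2 * m1 + t < len by lia.
  have xm : x < 2 * m1 + t < len by lia.
  have := gap _ ml; rewrite (label_eq vte xm) /joined.
  by case: (runP x) => ?; case: (runP (2 * m1 + t)) => ? /=; lia.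
Qed.

(** * Classification of block relations by a threshold and a flag *)

Section Classification.

(** [R] stands for lying in the same block. It lives on natural numbers so that reflections such as
    [2 * n1 - i.+1] can be written without a range proof. *)
Variable R : rel nat.
Hypothesis R_lt : forall i j, R i j -> i < len.
Hypothesis R_refl : forall i, i < len -> R i i.
Hypothesis R_sym : forall i j, R i j -> R j i.
Hypothesis R_trans : forall j i k, R i j -> R j k -> R i k.
Hypothesis R_run : forall i j, R i j -> run i = run j -> i = j.
Hypothesis R_next : forall i j, R i j -> run j = (run i).+1 ->
  i + j + 1 = 2 * (nth 0 [:: n1; n1 + m1; n1 + m1 + n2] (run i)).
Hypothesis R_wrap : forall i j, R i j -> run i = 0 -> run j = 3 -> i + j + 1 = len.
Hypothesis R_mate : forall i, i < len -> exists2 j, R i j & odd (run i) != odd (run j).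
Hypothesis R_full : forall i j, R i j -> run i != run j -> odd (run i) = odd (run j) ->
  forall r, r < 4 -> exists2 k, R i k & run k = r.
Hypothesis R_noncrossing : forall i j k l,
  i < j -> j < k -> k < l -> R i k -> R j l -> R i j.

Let run0 i : i < n1 -> run i = 0. Proof. by case: runP => //; lia. Qed.
Let run1 i : n1 <= i < n1 + m1 -> run i = 1. Proof. by case: runP => //; lia. Qed.
Let run2 i : n1 + m1 <= i < n1 + m1 + n2 -> run i = 2.
Proof. by case: runP => //; lia. Qed.
Let run3 i : n1 + m1 + n2 <= i -> run i = 3. Proof. by case: runP => //; lia. Qed.

Let run1K i : run i = 1 -> n1 <= i < n1 + m1. Proof. by case: runP. Qed.
Let run3K i : run i = 3 -> n1 + m1 + n2 <= i. Proof. by case: runP. Qed.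

Let R01 i j : R i j -> run i = 0 -> run j = 1 -> i + j + 1 = 2 * n1.
Proof. by move=> Rij i0 j1; have := R_next Rij; rewrite i0 j1 => ->. Qed.
Let R12 i j : R i j -> run i = 1 -> run j = 2 -> i + j + 1 = 2 * (n1 + m1).
Proof. by move=> Rij i0 j1; have := R_next Rij; rewrite i0 j1 => ->. Qed.
Let R23 i j : R i j -> run i = 2 -> run j = 3 -> i + j + 1 = 2 * (n1 + m1 + n2).
Proof. by move=> Rij i0 j1; have := R_next Rij; rewrite i0 j1 => ->. Qed.

(** A mate with the opposite letter lies in the second or the fourth run, and the balance of the
    interval then leaves one position in each. *)
Lemma mate0 i : i < n1 ->
  R i (2 * n1 - i.+1) && (2 * n1 - i.+1 < n1 + m1)
  \/ R i (len - i.+1) && (n1 + m1 + n2 <= len - i.+1).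
Proof.
move=> i0; have [|j Rij] := @R_mate i; first lia.
have ji := R_lt (R_sym Rij); rewrite (run0 i0);
move rj: (run j) (runP j) => r hr; case: hr rj => //= hj rj _.
- left; have := R01 Rij (run0 i0) rj; have := run1K rj => h h'.
  have <- : j = 2 * n1 - i.+1 by lia.
  by rewrite Rij; lia.
- right; have := R_wrap Rij (run0 i0) rj; have := run3K rj => h h'.
  have <- : j = len - i.+1 by lia.
  by rewrite Rij; lia.
Qed.

Lemma mate1 i : n1 <= i < n1 + m1 ->
  R (2 * n1 - i.+1) i && (i < 2 * n1)
  \/ R i (2 * (n1 + m1) - i.+1) && (2 * (n1 + m1) - i.+1 < n1 + m1 + n2).
Proof.
move=> i0; have [|j Rij] := @R_mate i; first lia.
rewrite (run1 i0); move rj: (run j) (runP j) => r hr; case: hr rj => //= hj rj _.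
- left; have := R01 (R_sym Rij) rj (run1 i0) => h'.
  have <- : j = 2 * n1 - i.+1 by lia.
  by rewrite R_sym //; lia.
- right; have := R12 Rij (run1 i0) rj => h'.
  have <- : j = 2 * (n1 + m1) - i.+1 by lia.
  by rewrite Rij; lia.
Qed.

Lemma mate3 i : n1 + m1 + n2 <= i < len ->
  R (2 * (n1 + m1 + n2) - i.+1) i
  \/ R (len - i.+1) i && (len - i.+1 < n1).
Proof.
move=> i0; have i3 : run i = 3 by apply: run3; lia.
have [|j Rij] := @R_mate i; first lia.
rewrite i3; move rj: (run j) (runP j) => r hr; case: hr rj => //= hj rj _.
- right; have := R_wrap (R_sym Rij) rj i3 => h'.
  have <- : j = len - i.+1 by lia.
  by rewrite R_sym //; lia.
- left; have := R23 (R_sym Rij) rj i3 => h'.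
  have <- : j = 2 * (n1 + m1 + n2) - i.+1 by lia.
  by rewrite R_sym.
Qed.

(* The threshold [t] is the first position of the first run joined to the second run. *)
Lemma classification :
  exists te : nat * bool, valid te.1 te.2 /\
    forall i j, i < len -> j < len -> R i j = (label te.1 te.2 i == label te.1 te.2 j).
Proof.
pose p i := (n1 <= i) || R i (2 * n1 - i.+1) && (2 * n1 - i.+1 < n1 + m1).
(* The disjunct [n1 <= i] guarantees a minimum: [t = n1] when no position of the first run is joined
   to the second. *)
have [|t pt tmin] := @ex_minnP p; first by exists n1; rewrite /p leqnn.
have tn1 : t <= n1 by apply: tmin; rewrite /p leqnn.
(* For [t < n1] the block of [t] meets the second run; if it meets the fourth as well, it is the
   quadruple. *)
pose e := [&& t < n1, R t (len - t.+1) & n1 + m1 + n2 <= len - t.+1].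
have t01 : t < n1 -> R t (2 * n1 - t.+1) && (2 * n1 - t.+1 < n1 + m1).
  by move=> lt; move: pt; rewrite /p leqNgt lt.
have low i : i < t -> R i (len - i.+1) && (n1 + m1 + n2 <= len - i.+1).
  move=> it; have [|h|//] := @mate0 i; first lia.
  by have := tmin i; rewrite /p h orbT => /(_ isT); lia.
have lowN i j : i < t -> run j = 1 -> R i j -> False.
  move=> it rj Rij; have ri : run i = 0 by apply: run0; lia.
  have h := R01 Rij ri rj; have := run1K rj => h'.
  have := tmin i; rewrite /p; have -> : 2 * n1 - i.+1 = j by lia.
  by rewrite Rij => /(_ _) H; have : t <= i; [apply: H; lia | lia].
have highN i j : t < i < n1 -> run j = 3 -> R i j -> False.
  move=> it rj Rij; have ri : run i = 0 by apply: run0; lia.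
  have rt : run t = 0 by apply: run0; lia.
  (* The arc from [t] to the second run would cross the arc from [i] to [j], so [t] and [i] would
     share a block and a run. *)
  have /andP[Rt ht] := t01 (ltac:(lia)); have hj := run3K rj.
  have := R_noncrossing _ _ _ Rt Rij => /(_ ltac:(lia) ltac:(lia) ltac:(lia)) Rti.
  by have := R_run Rti; rewrite rt ri; lia.
have high i : t <= i < n1 -> R i (2 * n1 - i.+1) && (2 * n1 - i.+1 < n1 + m1).
  move=> /andP[]; rewrite leq_eqVlt => /orP[/eqP <- /t01 //|ti i0].
  have [//|/andP[Rh h]] := mate0 i0.
  by exfalso; apply: (highN i (len - i.+1)) => //; [lia | exact: run3].
have e03 j : t < n1 -> run j = 3 -> R t j -> e.
  move=> lt rj Rtj; have := R_wrap Rtj (run0 lt) rj; have := run3K rj => hj h.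
  have E : len - t.+1 = j by lia.
  by rewrite /e lt E Rtj.
have valid_te : valid t e.
  rewrite /valid; apply/and3P; split.
  - by have [/t01|] := ltnP t n1; lia.
  - by rewrite /e; case: ltnP => /=; lia.
  - case: (boolP e) => [|_]; first by rewrite /e; lia.
    by case: (posnP t) => [->|t0] //; have := low t.-1; lia.
exists (t, e); split; first exact: valid_te.
(* Two facts give the equivalence: each position is related to its label, and related labels
   coincide ([rep_inj]). *)
rewrite /=; have label_joined i : i < len -> R i (label t e i).
  move=> il; rewrite /label; case: (runP i) => hi; first exact: R_refl.
  - case: ifP => h; last exact: R_refl.
    have /andP[Rh h'] := high (2 * n1 - i.+1) (ltac:(lia)).
    have E : 2 * n1 - (2 * n1 - i.+1).+1 = i by lia.
    by rewrite E in Rh; apply: R_sym.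
  - case: ifP => h.
      (* The reflection of [i] in the second run is at least [2 * n1 - t]; a mate in the first run
         would lie below [t], which [lowN] excludes, so its mate is [i]. *)
      have [|/andP[Rh h']|/andP[Rh h']] := @mate1 (2 * (n1 + m1) - i.+1); first lia.
        exfalso; apply: (lowN _ _ _ _ Rh); first lia.
        by apply: run1; lia.
      have E : 2 * (n1 + m1) - (2 * (n1 + m1) - i.+1).+1 = i by lia.
      by rewrite E in Rh; apply: R_sym.
    case: ifP => [/andP[/and3P[lt Rt ht] /eqP it]|_]; last exact: R_refl.
    have /andP[Rt' ht'] := t01 lt.
    have r1 : run (2 * n1 - t.+1) = 1 by apply: run1; lia.
    have r3 : run (len - t.+1) = 3 by apply: run3.
    (* The block of [t] meets both runs of stars, hence all four runs; its element in the third run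
       is forced to be [2 * m1 + t]. *)
    have full := R_full (R_trans (R_sym Rt') Rt); rewrite r1 r3 in full.
    have [l Rl rl] := full isT erefl 2 isT.
    have := R12 Rl r1 rl => h'.
    have -> : i = l by lia.
    by apply: R_sym; apply: R_trans Rt' Rl.
  - case: ifP => h.
      have [it|it] := ltnP (len - i.+1) t.
        have /andP[Rh _] := low _ it.
        have E : len - (len - i.+1).+1 = i by lia.
        by rewrite E in Rh; apply: R_sym.
      case ee: e h => /= h; last lia.
      have E : t = len - i.+1 by lia.
      have /and3P[_ Rt _] := ee.
      have E' : len - t.+1 = i by lia.
      by rewrite E' in Rt; rewrite -E; apply: R_sym.
    have [|Rh|/andP[Rh h']] := @mate3 i; first lia; first exact: R_sym.
    have r3 : run i = 3 by apply: run3; lia.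
    have [/eqP it|it] := eqVneq (len - i.+1) t.
      have ee : e by apply: (e03 i) => //; [lia | rewrite -(eqP it)].
      by rewrite ee in h; lia.
    by exfalso; apply: (highN _ _ _ _ Rh) => //; lia.
have e_run i j k : i < n1 -> R i j -> R i k -> run j = 1 -> run k = 3 -> e /\ i = t.
  move=> i0 Rij Rik rj rk.
  have [it|it] := ltnP i t; first by case: (lowN _ _ it rj Rij).
  have [E|ne] := eqVneq i t; last by case: (@highN i k) => //; lia.
  by split=> //; apply: (e03 k) => //; rewrite -E.
have e_full i j : i < n1 -> R i j -> run j = 2 -> e /\ i = t.
  move=> i0 Rij rj; have ri := run0 i0.
  have full r : r < 4 -> exists2 k, R i k & run k = r by apply: (R_full Rij); rewrite ri rj.
  have [k Rik rk] := full 1 isT; have [l Ril rl] := full 3 isT.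
  exact: e_run i0 Rik Ril rk rl.
(* Candidates for block minima: the first run, the second-run positions not joined to the first, and
   the third-run positions beyond those joined to earlier runs. *)
have rep i : i < len -> [|| label t e i < n1,
    (n1 <= label t e i < n1 + m1) && (2 * n1 <= label t e i + t) |
    (n1 + m1 <= label t e i < n1 + m1 + n2) && (2 * m1 + t + e <= label t e i)].
  move=> il; move: valid_te; rewrite /valid /label => vte.
  by case: (runP i) => hi; repeat (case: ifP => ?); lia.
have rep_inj a b : [|| a < n1, (n1 <= a < n1 + m1) && (2 * n1 <= a + t) |
      (n1 + m1 <= a < n1 + m1 + n2) && (2 * m1 + t + e <= a)] ->
    [|| b < n1, (n1 <= b < n1 + m1) && (2 * n1 <= b + t) |
      (n1 + m1 <= b < n1 + m1 + n2) && (2 * m1 + t + e <= b)] ->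
    R a b -> run a <= run b -> a = b.
  move=> ra rb Rab; have [/(R_run Rab) //|] := eqVneq (run a) (run b).
  move: ra rb => /or3P[ha|/andP[ha ta]|/andP[ha ta]] /or3P[hb|/andP[hb tb]|/andP[hb tb]];
    rewrite ?(run0 ha) ?(run1 ha) ?(run2 ha) ?(run0 hb) ?(run1 hb) ?(run2 hb) //= => _ _.
  - exfalso; have h := R01 Rab (run0 ha) (run1 hb).
    by apply: (lowN a b) Rab; [lia | exact: run1].
  (* Here [a] is [t] and [b] is the third vertex [2 * m1 + t] of the quadruple, just below the bound
     [2 * m1 + t + e]. *)
  - have [ee at_] := e_full _ _ ha Rab (run2 hb).
    have /andP[Rh h] := high a (ltac:(lia)).
    have r1 : run (2 * n1 - a.+1) = 1 by apply: run1; lia.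
    have := R12 (R_trans (R_sym Rh) Rab) r1 (run2 hb).
    by rewrite ee in tb; lia.
  - by have := R12 Rab (run1 ha) (run2 hb); lia.
move=> i j il jl; apply/idP/eqP => [Rij|E].
  have Rlab : R (label t e i) (label t e j).
    by apply: R_trans (label_joined _ jl); apply: R_trans Rij; apply: R_sym; apply: label_joined.
  case/orP: (leq_total (run (label t e i)) (run (label t e j))) => h.
    by apply: rep_inj => //; apply: rep.
  by apply/esym; apply: rep_inj (R_sym Rlab) h => //; apply: rep.
by apply: R_trans (label_joined _ il) _; rewrite E; apply: R_sym; apply: label_joined.
Qed.

End Classification.

(** * Blocks of an arbitrary partition in NC(S) *)

Section NoncrossingPartition.

Variable P : {set {set 'I_(size s)}}.
Hypothesis P_NC : P \in NC s.

Implicit Types (B : {set 'I_(size s)}) (x y z : 'I_(size s)).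

Lemma NC_partition : partition P setT.
Proof. by move: P_NC; rewrite inE => /and3P[]. Qed.

Lemma NC_even B : B \in P -> ~~ odd #|B|.
Proof. by move: P_NC; rewrite inE => /and3P[_ _ /forall_inP h] /h /andP[]. Qed.

Lemma NC_noncrossing B1 B2 (a b c d : 'I_(size s)) : B1 \in P -> B2 \in P ->
  a < b -> b < c -> c < d -> a \in B1 -> c \in B1 -> b \in B2 -> d \in B2 -> B1 = B2.
Proof.
move=> P1 P2 ab bc cd a1 c1 b2 d2; apply/eqP; apply: contraT => neq.
move: P_NC; rewrite inE => /and3P[_ /forall_inP/(_ _ P1)/forall_inP/(_ _ P2) + _].
rewrite neq => /forallP/(_ a)/forallP/(_ b)/forallP/(_ c)/forallP/(_ d).
by rewrite ab bc cd a1 c1 b2 d2.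
Qed.

Lemma NC_block_eq B1 B2 x : B1 \in P -> B2 \in P -> x \in B1 -> x \in B2 -> B1 = B2.
Proof.
have tiP := partition_trivIset NC_partition => P1 P2 x1 x2.
by rewrite -(def_pblock tiP P1 x1) (def_pblock tiP P2 x2).
Qed.

Lemma NC_alternating B x y : B \in P -> x \in B -> y \in B -> x < y ->
  (forall z, z \in B -> ~~ (x < z < y)) -> odd (run x) != odd (run y).
Proof.
move=> PB xB yB xy gap; move: P_NC; rewrite inE => /and3P[_ _ /forall_inP/(_ _ PB)/andP[_]].
move=> /forall_inP/(_ _ xB)/forall_inP/(_ _ yB); rewrite xy !entry_run.
by have /forall_inP -> := gap; rewrite /= (inj_eq negb_inj).
Qed.

(** The witness is the successor of [x] in its block, to which alternation applies. *)
Lemma NC_next B x y : B \in P -> x \in B -> y \in B -> x < y ->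
  exists2 z, z \in B & (x < z <= y) && (odd (run x) != odd (run z)).
Proof.
move=> PB xB yB xy.
have [z /andP[zB xz] zmin] : exists2 z, (z \in B) && (x < z) &
    forall w, w \in B -> x < w -> z <= w.
  case: (@arg_minnP _ y (fun z => (z \in B) && (x < z)) (@nat_of_ord _)).
    by rewrite yB.
  by move=> z zP zmin; exists z => // w wB xw; apply: zmin; rewrite wB.
exists z => //; rewrite xz zmin //=; apply: (NC_alternating PB) => // w wB.
by apply/negP => /andP[xw wz]; have := zmin w wB xw; lia.
Qed.

Lemma NC_prev B x y : B \in P -> x \in B -> y \in B -> y < x ->
  exists2 z, z \in B & (y <= z < x) && (odd (run x) != odd (run z)).
Proof.
move=> PB xB yB yx.
have [z /andP[zB zx] zmax] : exists2 z, (z \in B) && (z < x) &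
    forall w, w \in B -> w < x -> w <= z.
  case: (@arg_maxnP _ y (fun z => (z \in B) && (z < x)) (@nat_of_ord _)).
    by rewrite yB.
  by move=> z zP zmax; exists z => // w wB xw; apply: zmax; rewrite wB.
exists z => //; rewrite zx zmax //= eq_sym; apply: (NC_alternating PB) => // w wB.
by apply/negP => /andP[zw wx]; have := zmax w wB wx; lia.
Qed.

(** If a block had two elements in one run, the successor of the smaller would lie in that run too,
    yet carry the opposite letter. *)
Lemma NC_run_inj B : B \in P -> {in B &, injective (fun x => run x)}.
Proof.
move=> PB; suff lt_run x y : x \in B -> y \in B -> x < y -> run x != run y.
  move=> x y xB yB /eqP E; apply/val_inj/eqP => /=; apply: contraLR E.
  by case: (ltngtP x y) => // [/(lt_run _ _ xB yB)|/(lt_run _ _ yB xB)] //; rewrite eq_sym.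
move=> xB yB xy; have [z zB /andP[/andP[xz zy]]] := NC_next PB xB yB xy.
by apply: contraNneq => E; have := run_le (ltnW xz); have := run_le zy; rewrite -E => ? ?;
   have -> : run z = run x by lia.
Qed.

Definition run_ord x : 'I_4 := Ordinal (run_lt4 x).

Lemma card_run_image B : B \in P -> #|run_ord @: B| = #|B|.
Proof.
by move=> PB; apply: card_in_imset => x y xB yB [] /(NC_run_inj PB xB yB).
Qed.

Lemma NC_mate B x : B \in P -> x \in B -> exists2 y, y \in B & odd (run x) != odd (run y).
Proof.
move=> PB xB; have [y yB ne] : exists2 y, y \in B & y != x.
  apply/exists_inP; apply: contraT => /exists_inPn h.
  have E : B = [set x].
    apply/setP => z; rewrite inE; apply/idP/eqP => [zB|-> //].
    by apply/eqP; have := h z zB; rewrite negbK.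
  by have := NC_even PB; rewrite E cards1.
case: (ltngtP x y) => [xy|yx|/val_inj E]; last by rewrite E eqxx in ne.
  by have [z zB /andP[_ nz]] := NC_next PB xB yB xy; exists z.
by have [z zB /andP[_ nz]] := NC_prev PB xB yB yx; exists z.
Qed.

(** A mate of [x] with the opposite letter lies in a third run, so the block has at least three
    elements; even size then gives four, one for each run. *)
Lemma NC_full B x y : B \in P -> x \in B -> y \in B -> run x != run y ->
  odd (run x) = odd (run y) -> run_ord @: B = setT.
Proof.
move=> PB xB yB ne E; have [z zB nez] := NC_mate PB xB.
apply/eqP; rewrite eqEcard subsetT cardsT card_ord.
have := NC_even PB; rewrite -card_run_image //.
suff : 2 < #|run_ord @: B| by case: #|_| => [|[|[|[|?]]]].
have c3 : #|run_ord x |: [set run_ord y; run_ord z]| = 3.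
  rewrite cardsU1 cards2 !inE -!val_eqE /= (negbTE ne) /=.
  have -> : (run x == run z) = false by apply/negbTE; apply: contraNneq nez => ->.
  by have -> : (run y == run z) = false by apply/negbTE; apply: contraNneq nez => <-; rewrite E.
suff /subset_leq_card : run_ord x |: [set run_ord y; run_ord z] \subset run_ord @: B by rewrite c3.
by apply/subsetP => w; rewrite !inE => /or3P[] /eqP ->; apply: imset_f.
Qed.

Lemma NC_sum_run B (F : nat -> nat) : B \in P -> #|B| = 4 ->
  \sum_(z in B) F (run z) = F 0 + F 1 + F 2 + F 3.
Proof.
move=> PB B4; transitivity (\sum_(r in run_ord @: B) F r).
  by rewrite big_imset //= => x y xB yB [] /(NC_run_inj PB xB yB).
have -> : run_ord @: B = setT.
  by apply/eqP; rewrite eqEcard subsetT cardsT card_ord card_run_image ?B4.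
by rewrite (eq_bigl xpredT) => [|r]; rewrite ?inE // !big_ord_recr big_ord0.
Qed.

(** A block has two or four elements: a pair with opposite letters, or one element in every run. *)
Lemma NC_balanced B : B \in P ->
  \sum_(z in B) (~~ odd (run z) : nat) = \sum_(z in B) (odd (run z) : nat).
Proof.
move=> PB; have [x xB] : exists x, x \in B.
  by apply/set0Pn; apply: partition_neq0 NC_partition PB.
have [y yB ne] := NC_mate PB xB.
have le4 : #|B| <= 4 by have := max_card (mem (run_ord @: B)); rewrite card_ord card_run_image.
have xy : x != y by apply: contraNneq ne => ->.
have sub : [set x; y] \subset B by apply/subsetP => z; rewrite !inE => /orP[]/eqP ->.
have := subset_leq_card sub; rewrite cards2 xy => ge2.
have ev := NC_even PB.
have [B4|B4] := eqVneq #|B| 4.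
  by rewrite (NC_sum_run (fun r => ~~ odd r : nat) PB B4) (NC_sum_run (fun r => odd r : nat) PB B4).
have /eqP <- : [set x; y] == B.
  by rewrite eqEcard sub cards2 xy; move: le4 ge2 ev B4; case: #|B| => [|[|[|[|[|?]]]]].
rewrite !big_setU1 ?inE //= !big_set1.
by case: (odd (run x)) (odd (run y)) ne => [] [].
Qed.

(* A block other than [B] lies entirely inside or entirely outside [x, y], so
   the interval inherits the balance of its blocks. *)
Lemma NC_interval B x y : B \in P -> x \in B -> y \in B -> x < y ->
    \sum_(z in B | x <= z <= y) (~~ odd (run z) : nat) =
    \sum_(z in B | x <= z <= y) (odd (run z) : nat) ->
  \sum_(0 <= k < len) ((x <= k <= y) && ~~ odd (run k) : nat) =
  \sum_(0 <= k < len) ((x <= k <= y) && odd (run k) : nat).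
Proof.
move=> PB xB yB xy balB.
have sumE (F : nat -> bool) : \sum_(0 <= k < len) ((x <= k <= y) && F k : nat) =
    \sum_(A in P) \sum_(z in A | x <= z <= y) (F z : nat).
  rewrite -(set_partition_big_cond _ NC_partition) -size_word big_mkord [RHS]big_mkcond /=.
  by apply: eq_bigr => z _; rewrite inE /=; case: (x <= z <= y).
rewrite !sumE; apply: eq_bigr => A PA.
have [-> //|neq] := eqVneq A B.
have [/exists_inP[z0 z0A z0in]|none] := boolP [exists z in A, x <= z <= y]; last first.
  have E z : (z \in A) && (x <= z <= y) = false.
    by apply/negbTE; apply: contraNN none => /andP[zA zin]; apply/exists_inP; exists z.
  by rewrite !big_pred0.
have disj w : w \in A -> w \in B -> False.
  by move=> wA wB; rewrite (NC_block_eq PA PB wA wB) eqxx in neq.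
(* The ends belong to [B], so [z0] is strictly inside; an element of [A] outside the interval would
   then make [A] and [B] cross. *)
have [xz0 z0y] : x < z0 /\ z0 < y.
  case/andP: z0in => xz0 z0y; split; rewrite ltn_neqAle ?xz0 ?z0y andbT;
    by apply/eqP => /val_inj E; apply: (disj z0); rewrite // ?E // -E.
have E z : (z \in A) && (x <= z <= y) = (z \in A).
  case: (boolP (z \in A)) => //= zA; apply/andP; split; rewrite leqNgt; apply/negP => h.
    by case/eqP: neq; apply: (NC_noncrossing PA PB h xz0 z0y).
  by case/eqP: neq; apply/esym; apply: (NC_noncrossing PB PA xz0 z0y h).
by rewrite !(eq_bigl _ _ E) NC_balanced.
Qed.

(** Having one element per run, [B] meets [x, y] only at its ends, so the interval is balanced: the
    common boundary of the two runs is its midpoint. *)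
Lemma NC_consecutive B x y : B \in P -> x \in B -> y \in B -> run y = (run x).+1 ->
  x + y + 1 = 2 * nth 0 [:: n1; n1 + m1; n1 + m1 + n2] (run x).
Proof.
move=> PB xB yB E; have xy : x < y.
  by rewrite ltnNge; apply/negP => /(run_le); rewrite E ltnn.
have yl := ord_word_lt y.
have bal : \sum_(z in B | x <= z <= y) (~~ odd (run z) : nat) =
    \sum_(z in B | x <= z <= y) (odd (run z) : nat).
  have E2 z : (z \in B) && (x <= z <= y) = (z \in [set x; y]).
    rewrite !inE; apply/andP/orP => [[zB /andP[xz zy]]|[]/eqP ->]; last 2 first.
    - by rewrite leqnn ltnW.
    - by rewrite leqnn ltnW.
    have := run_le xz; have := run_le zy; rewrite E leq_eqVlt ltnS.
    case/orP => [/eqP h _|h h']; [right | left]; apply/eqP; apply: (NC_run_inj PB) => //.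
      by rewrite h.
    by apply/eqP; rewrite eqn_leq h.
  have ne : x \notin [set y] by rewrite inE neq_ltn xy.
  by rewrite !(eq_bigl _ _ E2) !big_setU1 // !big_set1 E /=; case: odd.
have := NC_interval PB xB yB xy bal; rewrite sum_even_run sum_odd_run.
move: E; case: (runP x) => hx; case: (runP y) => hy //= _; lia.
Qed.

(** All of [B] lies in [x, y], so the interval is balanced. As the whole word is balanced too,
    equally many letters are left out at either end. *)
Lemma NC_outer B x y : B \in P -> x \in B -> y \in B -> run x = 0 -> run y = 3 ->
  x + y + 1 = len.
Proof.
move=> PB xB yB rx ry; have xy : x < y.
  by rewrite ltnNge; apply/negP => /(run_le); rewrite rx ry.
have yl := ord_word_lt y.
have E z : (z \in B) && (x <= z <= y) = (z \in B).
  case: (boolP (z \in B)) => //= zB; apply/andP; split; rewrite leqNgt; apply/negP => h.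
    have := run_le (ltnW h); rewrite rx leqn0 => /eqP rz.
    by have := NC_run_inj PB zB xB; rewrite rz rx => /(_ erefl) zx; rewrite zx ltnn in h.
  have := run_le (ltnW h); have := run_lt4 z; rewrite ry ltnS => h1 h2.
  have rz : run z = 3 by apply/eqP; rewrite eqn_leq h1.
  by have := NC_run_inj PB zB yB; rewrite rz ry => /(_ erefl) zy; rewrite zy ltnn in h.
have := NC_interval PB xB yB xy; rewrite !(eq_bigl _ _ E) NC_balanced // => /(_ erefl).
rewrite sum_even_run sum_odd_run.
by move: rx ry; case: (runP x) => hx; case: (runP y) => hy //= _; lia.
Qed.

End NoncrossingPartition.

(** * Correspondence between NC(S) and the admissible pairs [(t, e)] *)

Lemma NC_run_partition (P : {set {set 'I_(size s)}}) : P \in NC s ->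
  exists t e, valid t e /\ P = run_partition t e.
Proof.
move=> P_NC; have partP := NC_partition P_NC.
have Px (x : 'I_(size s)) : x \in cover P by rewrite (cover_partition partP) inE.
pose R : rel nat := fun i j => [exists B in P,
  [exists x in B, val x == i] && [exists y in B, val y == j]].
have RP i j : reflect (exists B (x y : 'I_(size s)),
    [/\ B \in P, x \in B, y \in B, val x = i & val y = j]) (R i j).
  apply: (iffP exists_inP) => [[B PB /andP[/exists_inP[x xB /eqP xi] /exists_inP[y yB /eqP yj]]]|].
    by exists B, x, y.
  move=> [B [x [y [PB xB yB xi yj]]]]; exists B => //.
  by apply/andP; split; apply/exists_inP; [exists x | exists y] => //; apply/eqP.
have toR B (x y : 'I_(size s)) : B \in P -> x \in B -> y \in B -> R x y.
  by move=> PB xB yB; apply/RP; exists B, x, y.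
have [||||||||||[t e] [vte Rlab]] := @classification R.
- by move=> i j /RP[B [x [y [_ _ _ <- _]]]]; exact: ord_word_lt.
- move=> i il; rewrite -size_word in il; pose x := Ordinal il.
  by apply: (@toR (pblock P x) x x); rewrite ?pblock_mem ?mem_pblock.
- by move=> i j /RP[B [x [y [PB xB yB <- <-]]]]; exact: toR yB xB.
- move=> j i k /RP[B [x [y [PB xB yB <- <-]]]] /RP[B' [y' [z [PB' yB' zB']]]] /val_inj E <-.
  by rewrite E in yB'; rewrite -(NC_block_eq P_NC PB PB' yB yB') in zB'; apply: toR zB'.
- by move=> i j /RP[B [x [y [PB xB yB <- <-]]]] /(NC_run_inj P_NC PB xB yB) ->.
- by move=> i j /RP[B [x [y [PB xB yB <- <-]]]] E; apply: (NC_consecutive P_NC PB).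
- by move=> i j /RP[B [x [y [PB xB yB <- <-]]]]; apply: (NC_outer P_NC PB).
- move=> i il; rewrite -size_word in il; pose x := Ordinal il.
  have xB : x \in pblock P x by rewrite mem_pblock.
  have PB : pblock P x \in P by rewrite pblock_mem.
  by have [y yB ne] := NC_mate P_NC PB xB; exists (val y) => //; apply: toR PB xB yB.
- move=> i j /RP[B [x [y [PB xB yB <- <-]]]] ne E r r4.
  have := in_setT (Ordinal r4); rewrite -(NC_full P_NC PB xB yB ne E) => /imsetP[z zB [rz]].
  by exists (val z) => //; apply: toR PB xB zB.
- move=> i j k l ij jk kl /RP[B [x [z [PB xB zB xi zk]]]] /RP[B' [y [w [PB' yB' wB' yj wl]]]].
  subst i j k l; have E := NC_noncrossing P_NC PB PB' ij jk kl xB zB yB' wB'.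
  by rewrite -E in yB'; exact: toR yB'.
exists t, e; split=> //; rewrite -(preim_partition_pblock partP).
apply: eq_in_imset => x _; apply/setP => y; rewrite !inE /=.
rewrite -Rlab ?ord_word_lt // eq_pblock ?(partition_trivIset partP) //.
apply/idP/RP => [yx|[B [x' [y' [PB xB yB /val_inj <- /val_inj <-]]]]].
  by exists (pblock P x), x, y; rewrite pblock_mem ?mem_pblock.
by rewrite (def_pblock (partition_trivIset partP) PB xB).
Qed.

(** The partition determines [t], since the smaller of two thresholds is joined to the second run in
    only one of them; then [e] says whether [t] is also joined to [len - t.+1]. *)
Lemma run_partition_inj t e t' e' : valid t e -> valid t' e' ->
  run_partition t e = run_partition t' e' -> t = t' /\ e = e'.
Proof.
have same u d u' d' i j : run_partition u d = run_partition u' d' ->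
    valid u d -> valid u' d' -> i < j < len -> joined u d i j = joined u' d' i j.
  move=> E vu vu' ij; rewrite -!label_eq //.
  have il : i < size s by rewrite size_word; lia.
  have jl : j < size s by rewrite size_word; lia.
  have part u0 d0 : (label u0 d0 i == label u0 d0 j) =
      (Ordinal jl \in pblock (run_partition u0 d0) (Ordinal il)).
    rewrite pblock_equivalence_partition ?inE //.
    by split=> // /eqP ->.
  by rewrite !part E.
have lt u d u' d' : run_partition u d = run_partition u' d' ->
    valid u d -> valid u' d' -> u < u' -> False.
  move=> E vu vu' uu'; have {same} := same u d u' d' u (2 * n1 - u.+1) E vu vu'.
  move: vu vu'; rewrite /valid => /and3P[a1 a2 a3] /and3P[b1 b2 b3].
  have r0 : run u = 0 by rewrite /run; lia.
  have r1 : run (2 * n1 - u.+1) = 1 by rewrite /run; lia.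
  have ij : u < 2 * n1 - u.+1 < len by lia.
  have j1 : joined u d u (2 * n1 - u.+1) by rewrite /joined r0 r1 /=; lia.
  have j2 : joined u' d' u (2 * n1 - u.+1) = false.
    by rewrite /joined r0 r1 /= !andbF !orbF leqNgt uu' /= andbF.
  by rewrite j1 j2 => /(_ ij).
have ltb u : run_partition u false = run_partition u true ->
    valid u false -> valid u true -> False.
  move=> E vu vu'; have {same} := same u false u true u (len - u.+1) E vu vu'.
  move: vu vu'; rewrite /valid => /and3P[a1 a2 a3] /and3P[b1 b2 b3].
  have r0 : run u = 0 by rewrite /run; lia.
  have r3 : run (len - u.+1) = 3 by rewrite /run; lia.
  have ij : u < len - u.+1 < len by lia.
  have j1 : joined u true u (len - u.+1) by rewrite /joined r0 r3 /=; lia.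
  have j2 : joined u false u (len - u.+1) = false.
    by rewrite /joined r0 r3 /= !orbF addn0 ltnn andbF.
  by rewrite j1 j2 => /(_ ij).
move=> v v' E; have [l|l|tt'] := ltngtP t t'.
- by case: (lt _ _ _ _ E v v').
- by case: (lt _ _ _ _ (esym E) v' v).
subst t'; split=> //; case: e e' v v' E => [] [] // v v' E.
  by case: (ltb _ (esym E) v' v).
by case: (ltb _ E v v').
Qed.

Lemma NC2_run_partition t e : valid t e -> (run_partition t e \in NC2 s) = ~~ e.
Proof.
move=> vte; rewrite inE run_partition_NC //=.
apply/forall_inP/idP => [all2|ne B BQ]; last by rewrite (card_block vte BQ) (negbTE ne).
apply/negP => ee; rewrite ee in vte all2.
have tl : t < size s by rewrite size_word; move: vte; rewrite /valid; lia.
have partQ : partition (run_partition t true) setT by exact: preim_partitionP.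
have tc : Ordinal tl \in cover (run_partition t true).
  by rewrite (cover_partition partQ) inE.
have := all2 _ (pblock_mem tc); rewrite (card_block vte (pblock_mem tc)) /=.
suff -> : [exists i in pblock (run_partition t true) (Ordinal tl), label t true i == t] by [].
apply/exists_inP; exists (Ordinal tl); first by rewrite mem_pblock.
by rewrite /= /label; move: vte; rewrite /valid; case: (runP t) => //; lia.
Qed.

End FourRuns.

(** * Counting the admissible pairs *)

Theorem theorem3p8 (n1 m1 n2 m2 : nat) :
  (1 <= n1)%N -> (1 <= m1)%N -> (1 <= n2)%N -> (1 <= m2)%N ->
  n1 + n2 = m1 + m2 ->
  #|NC2 (word_S n1 m1 n2 m2)| = 1 + minn (minn n1 m1) (minn n2 m2) /\
  #|NC (word_S n1 m1 n2 m2)| = 1 + 2 * minn (minn n1 m1) (minn n2 m2).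
Proof.
move=> _ _ _ _ bal; set K := minn (minn n1 m1) (minn n2 m2).
set s := word_S n1 m1 n2 m2.
(* Shifting [t] by the truncated [n1 - m1] turns the upper bounds into [K]: by balance, [n1 >= m1]
   if and only if [m2 >= n2]. *)
have validE t e : valid n1 m1 m2 t e = (n1 - m1 <= t) && (t - (n1 - m1) + e <= K).
  by rewrite /valid /K; lia.
(* The shifted threshold takes [K + 1] values without a quadruple and [K] values with one. *)
pose fam e (k : 'I_(K + ~~ e)) := run_partition n1 m1 n2 m2 (n1 - m1 + k) e.
have fam_valid e (k : 'I_(K + ~~ e)) : valid n1 m1 m2 (n1 - m1 + k) e.
  by rewrite validE; have := ltn_ord k; case: e k => k /=; lia.
have fam_surj t e : valid n1 m1 m2 t e -> exists k, run_partition n1 m1 n2 m2 t e = @fam e k.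
  rewrite validE => vte; have kK : t - (n1 - m1) < K + ~~ e by case: e vte => /=; lia.
  by exists (Ordinal kK); rewrite /fam /= subnKC //; case/andP: vte.
have card_fam e : #|[set @fam e k | k : 'I_(K + ~~ e)]| = K + ~~ e.
  rewrite card_imset ?card_ord // => k l /(run_partition_inj bal (fam_valid _ k) (fam_valid _ l)).
  by case=> /addnI/val_inj.
have E2 : NC2 s = [set @fam false k | k : 'I_(K + ~~ false)].
  apply/setP => P; apply/idP/imsetP => [P2|[k _ ->]]; last by rewrite NC2_run_partition.
  have [|t [e [vte PE]]] := NC_run_partition bal (P := P); first by case/setIdP: P2.
  move: P2; rewrite PE NC2_run_partition // => ne; rewrite (negbTE ne) in vte *.
  by have [k ->] := fam_surj _ _ vte; exists k.
(* The partitions that are not pairings are those with a quadruple; they supply the second [K]. *)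
have E4 : NC s :\: NC2 s = [set @fam true k | k : 'I_(K + ~~ true)].
  apply/setP => P; rewrite inE; apply/andP/imsetP => [[P2 PNC]|[k _ ->]]; last first.
    by rewrite NC2_run_partition // run_partition_NC.
  have [t [e [vte PE]]] := NC_run_partition bal PNC.
  move: P2; rewrite PE NC2_run_partition // negbK => ee; rewrite ee in vte *.
  by have [k ->] := fam_surj _ _ vte; exists k.
have sub : NC2 s \subset NC s by apply/subsetP => P /setIdP[].
rewrite -(cardsID (NC2 s) (NC s)) (setIidPr sub) E4 E2 !card_fam /=.
by split; lia.
Qed.
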